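(* Let $d\geq 10^8$ be an integer and let $G=(V,E)$ be a finite simple $d$-regular graph. Then $G$ admits a vertex-colouring edge $3$-weighting, i.e. there exists $\omega:E\to\{1,2,3\}$ such that $\sigma_\omega(u)\neq\sigma_\omega(v)$ for every edge $uv\in E$, where $\sigma_\omega(v):=\sum_{u\in N(v)}\omega(uv)$.
   Context: For a graph $G=(V,E)$, an edge $k$-weighting is a map $\omega:E\to\{1,2,\ldots,k\}$; the weighted degree (sum) of a vertex $v$ is $\sigma_\omega(v)=\sum_{u\in N(v)}\omega(uv)$, where $N(v)$ is the set of neighbours of $v$. The weighting is vertex-colouring if adjacent vertices have distinct sums. *)

(* Defs.v *)
From mathcomp Require Import all_boot.

Set Implicit Arguments.
Unset Strict Implicit.
Unset Printing Implicit Defensive.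

(* A finite simple graph on V is a symmetric irreflexive relation e : rel V;  *)
(* an edge uv is the unordered pair [set u; v].                               *)

Definition neighbours (V : finType) (e : rel V) (v : V) : {set V} :=
  [set u | e v u].

Definition edges (V : finType) (e : rel V) : {set {set V}} :=
  [set [set p.1; p.2] | p in [set p : V * V | e p.1 p.2]].

Definition regular (V : finType) (e : rel V) (d : nat) : Prop :=
  forall v : V, #|neighbours e v| = d.

(* w is a total function on {set V}; only its values on edges are relevant.   *)
Definition edge_weighting (V : finType) (e : rel V) (k : nat)
    (w : {set V} -> nat) : Prop :=
  forall f : {set V}, f \in edges e -> 1 <= w f <= k.

Definition wsum (V : finType) (e : rel V) (w : {set V} -> nat) (v : V) : nat :=
  \sum_(u in neighbours e v) w [set u; v].

Definition vertex_colouring (V : finType) (e : rel V)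
    (w : {set V} -> nat) : Prop :=
  forall u v : V, e u v -> wsum e w u <> wsum e w v.

(* Main.v *)
Require Import Defs.
From mathcomp Require Import all_boot all_order all_algebra zify.

Set Implicit Arguments.
Unset Strict Implicit.
Unset Printing Implicit Defensive.

Import Order.TTheory GRing.Theory Num.Theory.

(** Subtract 2 from all weights, so that edges carry offsets -1, 0, 1; we may
    assume that G is connected.  Choose an independent set R, as large as
    possible such that the bipartite graph H of the edges between R and its
    complement B links R together; then R dominates and H is connected.
    We make the vertices of R even and those of B odd, by giving odd offsets to
    a subgraph J of H with odd degree on B and even degree on R.  Take a maximum
    cut of G[B] and let the edges of J be +1 at one side and -1 at the other.
    Maximality of the cut says precisely that any unit flow on the non-cut edges
    of G[B] can be rerouted through the cut edges; hence, processing the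
    vertices in some order, each of the k edges from v to earlier vertices on
    its side may move v by two away from 0 without moving the other end.  So v
    has k + 1 possible values and avoids its k earlier neighbours, while the two
    sides are separated by their signs.
    J exists when |B| is even.  If |B| is odd, a suitable vertex b of B whose
    removal leaves H connected is made even as well, and it remains to separate
    b from its neighbours in R.  If there are at least two of them, this is done
    by the choice of the signs on the edges from b to R.  If there is only one,
    r, then J is modified along a cycle through r; the maximality of R is used
    to find such a cycle when r has many neighbours of this kind. *)

(** * Integral flows *)

Section Flow.
Local Open Scope ring_scope.
Variables (V : finType) (c : rel V).
Hypothesis c_sym : symmetric c.

Definition unit_flow (phi : V -> V -> int) :=
  [/\ forall u v, phi u v = - phi v u,
      forall u v, phi u v <= 1 &
      forall u v, ~~ c u v -> phi u v = 0].

Definition residual (phi : V -> V -> int) : rel V :=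
  fun u v => c u v && (phi u v != 1).

(** One unit is pushed along every edge of the path. The second clause serves the induction: the
    path is simple, so after pushing along its rest the flow out of [u] is as before, and the first
    edge is still unsaturated. *)
Lemma push_path phi u p : unit_flow phi -> path (residual phi) u p ->
  uniq (u :: p) ->
  exists psi, [/\ unit_flow psi,
    forall x y, x \notin u :: p -> psi x y = phi x y &
    forall x, \sum_y psi x y =
      \sum_y phi x y + (x == u)%:R - (x == last u p)%:R].
Proof.
move=> phiF; elim: p u => [|v p IHp] u /=.
  by move=> _ _; exists phi; split=> // x; rewrite addrK.
case/andP=> /andP[cuv phi1] vp /andP[unp vpU].
have [psi [[psiN psi1 psi0] psiE psiS]] := IHp v vp vpU.
have uDv : u != v by move: unp; rewrite inE negb_or => /andP[].
pose d x y : int := ((x == u) && (y == v))%:R - ((x == v) && (y == u))%:R.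
exists (fun x y => psi x y + d x y); split; first split.
- move=> x y; rewrite /d psiN andbC [(y == v) && _]andbC; lia.
- move=> x y; rewrite /d; have := psi1 x y.
  have [->|_] /= := eqVneq x u; last by lia.
  have [->|_] /= := eqVneq y v; last by lia.
  have := psiE u v unp; case: phiF => _ /(_ u v); lia.
- move=> x y ncxy; rewrite psi0 // /d.
  have /negbTE-> : ~~ ((x == u) && (y == v)).
    by apply: contra ncxy => /andP[/eqP-> /eqP->].
  have /negbTE-> : ~~ ((x == v) && (y == u)).
    by apply: contra ncxy => /andP[/eqP-> /eqP->]; rewrite c_sym.
  by rewrite add0r subrr.
- move=> x y; rewrite inE negb_or => /andP[xu xp]; rewrite psiE // /d.
  rewrite (negbTE xu) /=; move: xp; rewrite inE negb_or => /andP[/negbTE-> _].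
  lia.
move=> x; rewrite big_split /= psiS /d sumrB.
have sumE (w z : V) : \sum_y ((x == w) && (y == z))%:R = (x == w)%:R :> int.
  case: (x == w) => /=; last by rewrite big1.
  by rewrite (bigD1 z) //= eqxx big1 ?addr0 // => i /negbTE->.
rewrite !sumE.
by move: (\sum_y phi x y) (x == u) (x == v) (x == last v p) => ? [] [] [] /=; lia.
Qed.

Lemma unit_flow_div_setC phi (X : {set V}) : unit_flow phi ->
  \sum_(v in X) \sum_u phi v u = \sum_(v in X) \sum_(u in ~: X) phi v u.
Proof.
case=> phiN _ _.
under eq_bigr => v _ do rewrite (bigID (mem X)) /=.
rewrite big_split /=.
suff -> : \sum_(v in X) \sum_(u in X) phi v u = 0.
  by rewrite add0r; apply: eq_bigr => v _; apply: eq_bigl => u; rewrite inE.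
have E : \sum_(v in X) \sum_(u in X) phi v u =
  - \sum_(v in X) \sum_(u in X) phi v u.
  rewrite {1}exchange_big /= -sumrN; apply: eq_bigr => v _.
  by rewrite -sumrN; apply: eq_bigr => u _; rewrite phiN.
by lia.
Qed.

(** Gale's feasibility theorem for unit capacities. While some vertex has supply left, either a
    residual path from it to a vertex in deficit lowers the total defect, or the set reachable from
    it has all outgoing edges saturated and violates the cut condition. *)
Lemma unit_flow_exists (b : V -> int) :
  \sum_v b v = 0 ->
  (forall X : {set V}, \sum_(v in X) b v <=
     \sum_(v in X) \sum_(u in ~: X) (c v u)%:R) ->
  exists2 phi, unit_flow phi & forall v, \sum_u phi v u = b v.
Proof.
move=> b0 bX.
suff H n phi : unit_flow phi ->
    (\sum_v absz (b v - \sum_u phi v u)%R <= n)%N ->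
    exists2 phi, unit_flow phi & forall v, \sum_u phi v u = b v.
  by apply: (H _ (fun _ _ => 0) _ (leqnn _)); split=> // *; rewrite oppr0.
elim: n phi => [|n IHn] phi phiF defect.
  exists phi => // v; move: defect; rewrite leqn0 sum_nat_eq0.
  by move=> /forallP/(_ v)/=; lia.
pose x v := b v - \sum_u phi v u.
have x0 : \sum_v x v = 0.
  rewrite sumrB b0 sub0r; have := unit_flow_div_setC setT phiF.
  rewrite big_mkcond /= (eq_bigr (fun v => \sum_u phi v u)) => [->|v _].
    rewrite big1 ?oppr0 // => v _; apply: big_pred0 => u; by rewrite !inE.
  by rewrite inE.
have [allx|/existsP[u xu]] := boolP [forall v, x v <= 0].
  exists phi => // v; suff : x v = 0 by rewrite /x; lia.
  apply/eqP; rewrite -oppr_eq0; apply: contraT => xv.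
  have : 0 < \sum_w - x w.
    rewrite (bigD1 v) //= ltr_pwDl ?sumr_ge0 //.
    - by move/forallP/(_ v): allx xv; lia.
    - by move=> w _; move/forallP/(_ w): allx; lia.
  by rewrite sumrN x0 oppr0.
rewrite -ltNge in xu.
pose X := [set v | connect (residual phi) u v].
have [/existsP[w /andP[]]|noX] := boolP [exists w, (w \in X) && (x w < 0)].
  rewrite inE => /connectP[p0 /shortenP[p up upU _] ->] xw.
  have [psi [psiF _ psiS]] := push_path phiF up upU.
  apply: (IHn psi psiF); rewrite -ltnS (leq_trans _ defect) //.
  have uw : u != last u p by apply: contraTneq xw => <-; rewrite -leNgt ltW.
  rewrite (bigD1 u) //= [X in (_ < X)%N](bigD1 u) //= -addSn leq_add //.
    rewrite psiS eqxx (negbTE uw) /=; move: xu; rewrite /x.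
    by move: (\sum_u0 phi u u0) => s; lia.
  apply: leq_sum => v vu; rewrite psiS (negbTE vu) /=.
  have [->|_] := eqVneq; [move: xw; rewrite /x /=; lia | rewrite /= addr0 subr0 //].
exfalso; have: 0 < \sum_(v in X) x v.
  rewrite (bigD1 u) ?inE ?connect0 //= ltr_pwDl // sumr_ge0 // => v /andP[vX _].
  by move: noX => /existsPn/(_ v); rewrite vX /= -leNgt.
rewrite sumrB unit_flow_div_setC // subr_gt0 ltNge.
rewrite (le_trans (bX X)) //; apply: ler_sum => v vX; apply: ler_sum => w.
rewrite !inE => wX; rewrite inE in vX.
have [cvw|] := boolP (c v w); last by case: phiF => _ _ phi0 /phi0 ->.
apply: contraT => phi1; case/negP: wX; apply: connect_trans vX (connect1 _).
by rewrite /residual cvw; move: phi1; lia.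
Qed.

End Flow.

(** * Colouring the two sides of a maximum cut *)

Section Subsets.
Variable V : finType.

Lemma subset_of_card (A B : {set V}) k :
  A \subset B -> #|A| <= k <= #|B| ->
  exists M : {set V}, [/\ A \subset M, M \subset B & #|M| = k].
Proof.
move=> AB; elim: k => [|k IHk] /andP[Ak kB].
  by exists A; split=> //; apply/eqP; rewrite -leqn0.
move: Ak; rewrite leq_eqVlt => /orP[/eqP Ak|Ak]; first by exists A.
have [|M [AM MB Mk]] := IHk; first by rewrite -ltnS Ak ltnW.
have /subsetPn[x xB xM] : ~~ (B \subset M).
  by apply: contraL kB => /subset_leq_card; rewrite Mk -leqNgt.
exists (x |: M); split; last by rewrite cardsU1 xM Mk.
- exact: subset_trans AM (subsetUr _ _).
- by rewrite subUset sub1set xB.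
Qed.

Lemma pigeonhole (F : finType) (f : V -> F) (A : {set V}) :
  #|F| < #|A| -> exists x y, [/\ x \in A, y \in A, x != y & f x = f y].
Proof.
move=> FA; have /dinjectivePn[x xA [y /andP[yx yA] fxy]] :
    ~~ dinjectiveb f (mem A).
  apply: contraL FA => /dinjectiveP inj; rewrite -leqNgt.
  by rewrite -(card_in_imset inj) max_card.
by exists x, y; rewrite eq_sym yx.
Qed.

End Subsets.

Section Colouring.
Local Open Scope ring_scope.
Variables (V : finType) (g : rel V).
Hypothesis g_sym : symmetric g.

Definition sg (b : bool) : int := if b then 1 else -1.

(** Switching the sides of the vertices in [X] exchanges cut and non-cut edges between [X] and its
    complement and preserves all others, so in a maximum cut no switch can gain. *)
Lemma max_cut : exists s : V -> bool, forall X : {set V},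
  \sum_(v in X) \sum_(u in ~: X) (g v u && (s v == s u))%:R <=
  \sum_(v in X) \sum_(u in ~: X) (g v u && (s v != s u))%:R :> int.
Proof.
pose F (s : {ffun V -> bool}) := (\sum_v \sum_u (g v u && (s v != s u)))%N.
have [s _ smax] := arg_maxnP F (erefl : xpredT [ffun _ : V => true]).
exists s => X; pose t := [ffun v => s v (+) (v \in X)].
have FE (r : {ffun V -> bool}) : (F r)%:R =
  \sum_v \sum_(u | (v \in X) == (u \in X)) (g v u && (r v != r u))%:R
  + (\sum_(v in X) \sum_(u in ~: X) (g v u && (r v != r u))%:R) *+ 2 :> int.
  rewrite /F natr_sum.
  under eq_bigr => v _ do
    rewrite natr_sum (bigID (fun u => (v \in X) == (u \in X))) /=.
  rewrite big_split /=; congr (_ + _).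
  rewrite (bigID (mem X)) /= mulr2n; congr (_ + _).
    by apply: eq_bigr => v vX; apply: eq_bigl => u; rewrite vX inE; case: in_mem.
  rewrite [RHS]exchange_big /=; apply: eq_big => [v|v vX]; first by rewrite inE.
  apply: eq_big => [u|u _]; first by rewrite (negbTE vX); case: (u \in X).
  by rewrite g_sym eq_sym.
have : (F t)%:R <= (F s)%:R :> int by have := smax t isT; lia.
rewrite !FE.
have -> : \sum_v \sum_(u | (v \in X) == (u \in X)) (g v u && (t v != t u))%:R =
   \sum_v \sum_(u | (v \in X) == (u \in X)) (g v u && (s v != s u))%:R :> int.
  apply: eq_bigr => v _; apply: eq_bigr => u /eqP vu; rewrite !ffunE vu.
  by case: (s v); case: (s u); case: in_mem.
rewrite lerD2l lerMn2r /=; apply: le_trans; rewrite le_eqVlt; apply/orP; left.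
apply/eqP; apply: eq_bigr => v vX; apply: eq_bigr => u; rewrite inE => /negbTE uX.
by rewrite !ffunE vX uX; case: (s v); case: (s u).
Qed.

Variable s : V -> bool.
Hypothesis s_max : forall X : {set V},
  \sum_(v in X) \sum_(u in ~: X) (g v u && (s v == s u))%:R <=
  \sum_(v in X) \sum_(u in ~: X) (g v u && (s v != s u))%:R :> int.

Definition before (v : V) : {set V} :=
  [set u | [&& g v u, s u == s v & (enum_rank u < enum_rank v)%N]].

(* The inside edge from [v] to a selected earlier neighbour gets offset
   [sg (s v)], which moves both ends; a unit of flow through the cut edges
   cancels the effect at the earlier end and doubles it at [v]. *)
Lemma cut_weighting (m : V -> nat) : (forall v, m v <= #|before v|)%N ->
  exists a : V -> V -> int,
    [/\ forall u v, a u v = a v u, forall u v, ~~ g u v -> a u v = 0,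
        forall u v, -1 <= a u v <= 1 &
        forall v, \sum_u a v u = sg (s v) * (m v)%:R *+ 2].
Proof.
move=> mb.
have /fin_all_exists[Z Zm] v : exists M : {set V}, M \subset before v /\ #|M| = m v.
  have [|M [_ MB Mm]] := @subset_of_card _ set0 (before v) (m v) (sub0set _).
    by rewrite cards0 mb.
  by exists M.
have ZP u v : u \in Z v -> [/\ g v u, s u = s v & (enum_rank u < enum_rank v)%N].
  case: (Zm v) => /subsetP ZB _ /ZB; rewrite inE => /and3P[? /eqP ? ?].
  by split.
have Zasym u v : u \in Z v -> v \notin Z u.
  by move/ZP=> [_ _ uv]; apply/negP => /ZP[_ _]; lia.
(* [h] sends one unit from each vertex to its selected earlier neighbours along inside edges; its
   net outflow [b] is then realised by a flow [phi] through cut edges only. *)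
pose h v u : int := (u \in Z v)%:R - (v \in Z u)%:R.
pose c : rel V := fun v u => g v u && (s v != s u).
have c_sym : symmetric c by move=> u v; rewrite /c g_sym eq_sym.
have h_ins v u : h v u <= (g v u && (s v == s u))%:R.
  rewrite /h; have [/ZP[-> -> _]|_] /= := boolP (u \in Z v).
    by rewrite eqxx; lia.
  by case: (_ && _); case: (_ \in _).
have hN v u : h v u = - h u v by rewrite /h opprB.
pose b v := \sum_u h v u.
have bXE (X : {set V}) : \sum_(v in X) b v = \sum_(v in X) \sum_(u in ~: X) h v u.
  apply: (@unit_flow_div_setC V (fun _ _ => true) h X); split=> // u v.
  by rewrite /h; case: (_ \in _); case: (_ \in _).
have [||phi [phiN phi1 phi0] phiS] := @unit_flow_exists _ c c_sym b.
- have := bXE setT; rewrite big_mkcond /= (eq_bigr b) => [->|v _]; last by rewrite inE.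
  by rewrite big1 // => v _; rewrite big_pred0 // => u; rewrite !inE.
- move=> X; rewrite bXE; apply: le_trans (s_max X).
  by apply: ler_sum => v _; apply: ler_sum => u _.
pose x v u : int := sg (s v) * ((u \in Z v)%:R + (v \in Z u)%:R).
have xsym u v : x u v = x v u.
  rewrite /x addrC; have [/ZP[_ -> _]//|_] := boolP (u \in Z v).
  by have [/ZP[_ -> _]|_] := boolP (v \in Z u); rewrite ?mulr0.
have x_c u v : x u v != 0 -> ~~ c u v /\ g u v.
  have [/ZP[gvu uv _]|nuv] := boolP (u \in Z v); first by rewrite /c g_sym gvu uv eqxx.
  have [/ZP[gvu uv _]|nvu] := boolP (v \in Z u); first by rewrite /c gvu uv eqxx.
  by rewrite /x (negbTE nuv) (negbTE nvu) addr0 mulr0 eqxx.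
have x1 u v : -1 <= x u v <= 1.
  rewrite /x; have [/Zasym/negbTE->|_] := boolP (u \in Z v).
    by case: (s u).
  by case: (_ \in _); case: (s u).
(* [phi] is antisymmetric and the sign changes across a cut edge, so [f] is symmetric. *)
pose f v u := sg (s v) * phi v u.
exists (fun v u => x v u + f v u); split.
- move=> u v; rewrite xsym; congr (_ + _); rewrite /f.
  have [cuv|ncuv] := boolP (c u v).
    by rewrite phiN; case/andP: cuv => _; case: (s u); case: (s v) => //; rewrite /sg; lia.
  by rewrite !phi0 ?mulr0 // c_sym.
- move=> u v nguv; rewrite /f phi0 /c ?(negbTE nguv) // mulr0 addr0.
  by apply/eqP; apply: contraNT nguv => /x_c[].
- move=> u v; have [x0|/x_c[ncuv _]] := eqVneq (x u v) 0.
    rewrite x0 add0r /f; have := phi1 u v; have := phi1 v u; rewrite phiN.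
    by case: (s u); rewrite /sg; lia.
  by rewrite /f phi0 // mulr0 addr0.
(* If [v] is selected by [p] later vertices, then, up to the sign of its side, [x] contributes
   [m v + p] and the flow [m v - p]. *)
move=> v; rewrite big_split /= -!mulr_sumr phiS /b /h sumrB big_split /= -mulrDr.
rewrite addrACA subrr addr0 -mulr2n [LHS]mulrnAr; congr (_ *+ _); congr (_ * _).
case: (Zm v) => _ <-; rewrite -sum1_card natr_sum [RHS]big_mkcond /=.
by apply: eq_bigr => u _; case: (_ \in _).
Qed.

Lemma greedy (beta : V -> nat) : exists m : V -> nat,
  (forall v, m v <= #|before v|)%N /\
  (forall u v, g u v -> s u = s v -> u != v ->
     beta u + (m u).*2 <> beta v + (m v).*2)%N.
Proof.
suff H n : exists m : V -> nat, (forall v, m v <= #|before v|)%N /\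
   (forall v u, (enum_rank v < n)%N -> u \in before v ->
     beta u + (m u).*2 <> beta v + (m v).*2)%N.
  have [m [mb mP]] := H #|V|; exists m; split=> // u v guv suv nuv.
  have : enum_rank u != enum_rank v by rewrite (inj_eq enum_rank_inj).
  rewrite neq_ltn => /orP[] lt.
    by apply: mP; rewrite ?ltn_ord // inE g_sym guv suv eqxx.
  by move/esym; apply: mP; rewrite ?ltn_ord // inE guv suv eqxx.
elim: n => [|n [m [mb mP]]]; first by exists (fun=> 0%N).
have [nV|Vn] := ltnP n #|V|; last first.
  by exists m; split=> // v u vn; apply: mP; apply: leq_trans (ltn_ord _) Vn.
pose w := enum_val (Ordinal nV).
have rw : enum_rank w = n :> nat by rewrite enum_valK.
have [k kb kP] : exists2 k, (k <= #|before w|)%N &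
    (forall u, u \in before w -> beta u + (m u).*2 <> beta w + k.*2)%N.
  have [/existsP[k /forallP kP]|] := boolP [exists k : 'I_#|before w|.+1,
      [forall u, (u \in before w) ==> (beta u + (m u).*2 != beta w + k.*2)%N]].
    exists k; first by rewrite -ltnS.
    by move=> u ub; apply/eqP; have /implyP := kP u; apply.
  rewrite negb_exists => /forallP bad; exfalso.
  (* If every candidate were blocked, choosing a blocking neighbour for each would inject
     [#|before w|.+1] candidates into [before w]. *)
  have /fin_all_exists[t tP] (k : 'I_#|before w|.+1) :
      exists u, u \in before w /\ (beta u + (m u).*2 = beta w + k.*2)%N.
    have := bad k; rewrite negb_forall => /existsP[u].
    by rewrite negb_imply negbK => /andP[? /eqP ?]; exists u.
  have tinj : injective t.
    by move=> i j tij; case: (tP i) (tP j) => _; rewrite tij => -> [_] ?; apply: ord_inj; lia.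
  have := card_imset predT tinj; rewrite card_ord => cE.
  have : ([set t x | x in predT] \subset before w).
    by apply/subsetP => _ /imsetP[i _ ->]; case: (tP i).
  by move/subset_leq_card; rewrite cE ltnn.
exists (fun v => if v == w then k else m v); split.
  by move=> v; case: eqP => [->|].
move=> v u vn uv.
have uw : u != w.
  apply: contraTneq uv => ->; rewrite inE rw -[(n < _)%N]negbK -leqNgt -ltnS vn.
  by rewrite !andbF.
rewrite (negbTE uw); case: eqP => [vw|/eqP vw]; first by rewrite vw in uv *; apply: kP.
apply: mP => //; move: vn; rewrite ltnS leq_eqVlt => /orP[/eqP vn|//].
by case/eqP: vw; apply: enum_rank_inj; apply: val_inj; rewrite /= rw.
Qed.

End Colouring.

(** The cut is fixed before [beta] is given, because the odd subgraph that determines [beta] is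
    chosen later with the signs of the cut in view. *)
Lemma two_sided_colouring (V : finType) (g : rel V) :
  symmetric g -> irreflexive g ->
  exists s : V -> bool, forall beta : V -> nat,
  exists (a : V -> V -> int) (m : V -> nat),
    [/\ forall u v, a u v = a v u, forall u v, ~~ g u v -> a u v = 0%R,
        forall u v, (-1 <= a u v <= 1)%R,
        forall v, (\sum_u a v u = sg (s v) * (m v)%:R *+ 2)%R &
        forall u v, g u v -> s u = s v -> beta u + (m u).*2 <> beta v + (m v).*2].
Proof.
move=> g_sym g_irr; have [s s_max] := max_cut g_sym; exists s => beta.
have [m [mb mP]] := greedy g_sym s beta.
have [a [asym a0 a1 aS]] := cut_weighting g_sym s_max mb.
exists a, m; split=> // u v guv suv; apply: mP => //.
by apply: contraTneq guv => ->; rewrite g_irr.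
Qed.

(** * Parity joins and choices of signs *)

Section Parity.
Variable V : finType.
Implicit Types (i j H : rel V) (D T : {set V}).

Definition par j v := \big[addb/false]_u j v u.

Definition edge x y : rel V :=
  fun u v => ((u == x) && (v == y)) || ((u == y) && (v == x)).

Definition xor_rel i j : rel V := fun u v => i u v (+) j u v.

Lemma par_xor i j v : par (xor_rel i j) v = par i v (+) par j v.
Proof. exact: big_split. Qed.

Lemma eq_par i j v : i v =1 j v -> par i v = par j v.
Proof. by move=> ij; apply: eq_bigr => u _; apply: ij. Qed.

Lemma par_single (P : pred V) y : \big[addb/false]_u (P u && (u == y)) = P y.
Proof.
rewrite (bigD1 y) //= eqxx andbT big1 ?addbF // => u /negbTE->.
by rewrite andbF.
Qed.

Lemma par_edge x y v : x != y -> par (edge x y) v = (v == x) (+) (v == y).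
Proof.
move=> xy; rewrite /par /edge.
transitivity (\big[addb/false]_u ((v == x) && (u == y)) (+)
              \big[addb/false]_u ((v == y) && (u == x))).
  rewrite -big_split /=; apply: eq_bigr => u _.
  by have [->|_] //= := eqVneq v x; rewrite (negbTE xy) orbF addbF.
by rewrite !(par_single (fun=> _)).
Qed.

Lemma edge_sym x y : symmetric (edge x y).
Proof. by move=> u v; rewrite /edge orbC andbC [X in _ || X]andbC. Qed.

Lemma xor_sym i j : symmetric i -> symmetric j -> symmetric (xor_rel i j).
Proof. by move=> si sj u v; rewrite /xor_rel si sj. Qed.

Lemma par_card j v : par j v = odd #|[set u | j v u]|.
Proof.
rewrite -sum1_card big_mkcond /= (big_morph odd oddD (erefl : odd 0 = false)).
by apply: eq_bigr => u _; rewrite inE; case: (j v u).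
Qed.

(** The edges of a walk are added modulo 2, so that only its two ends keep odd degree, and none if
    they coincide. *)
Lemma path_join H x y : symmetric H -> irreflexive H -> connect H x y ->
  exists j, [/\ symmetric j, subrel j H &
    forall v, par j v = (v == x) (+) (v == y)].
Proof.
move=> Hs Hi /connectP[p]; elim: p x => [|z p IHp] x /=.
  move=> _ ->; exists (fun _ _ => false); split=> // v.
  by rewrite addbb /par big1.
case/andP=> xz zp yE; have [j [js jH jp]] := IHp z zp yE.
have xDz : x != z by apply: contraTneq xz => ->; rewrite Hi.
exists (xor_rel (edge x z) j); split.
- exact: xor_sym (@edge_sym _ _) js.
- move=> u v; rewrite /xor_rel; have [/jH//|_] := boolP (j u v); rewrite addbF.
  by case/orP=> /andP[/eqP-> /eqP->]; rewrite // Hs.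
move=> v; rewrite par_xor jp par_edge //.
by case: (v == x); case: (v == z); case: (v == y).
Qed.

(** Existence of a T-join: the vertices of [T] are paired off and the joins of the pairs are added
    modulo 2. *)
Lemma parity_join H D T : symmetric H -> irreflexive H ->
  (forall x y, x \in D -> y \in D -> connect H x y) ->
  T \subset D -> ~~ odd #|T| ->
  exists j, [/\ symmetric j, subrel j H & forall v, par j v = (v \in T)].
Proof.
move=> Hs Hi HD; have [n] := ubnP #|T|; elim: n T => // n IHn T Tn TD oT.
have [->|[x xT]] := set_0Vmem T.
  by exists (fun _ _ => false); split=> // v; rewrite inE /par big1.
have [T1|[y]] := set_0Vmem (T :\ x).
  by move: oT; rewrite (cardsD1 x) xT T1 cards0.
rewrite !inE => /andP[yx yT].
have cT : #|T| = (#|T :\ x :\ y|).+2.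
  by rewrite (cardsD1 x) xT (cardsD1 y (T :\ x)) !inE yx yT.
have [|||j [js jH jp]] := IHn (T :\ x :\ y).
- by rewrite cT in Tn; lia.
- by rewrite (subset_trans _ TD) // (subset_trans (subD1set _ _)) ?subD1set.
- by move: oT; rewrite cT /= negbK.
have [i [iS iH ip]] := path_join Hs Hi (HD x y (subsetP TD _ xT) (subsetP TD _ yT)).
exists (xor_rel i j); split; first exact: xor_sym.
  by move=> u v; rewrite /xor_rel; have [/jH//|_] := boolP (j u v); rewrite addbF => /iH.
move=> v; rewrite par_xor ip jp !inE.
have [->|_] := eqVneq v x; first by rewrite xT [x == y]eq_sym (negbTE yx) /=.
by have [->|_] := eqVneq v y; rewrite ?yT.
Qed.

End Parity.

(** * Choice of signs on the edges from one even vertex to its even neighbours *)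

Section Signs.
Local Open Scope ring_scope.
Variables (V : finType) (I : {set V}) (c : V -> int) (K : int).

(* With [k] minus signs the total is [t = K + #|I| - 2k]; then [r] must not have
   [c r = t - 1] with a plus sign, nor [c r = t + 1] with a minus sign. *)
Let N (t : int) : nat := #|[set r in I | c r == t]|.
Let f (k : nat) : nat := N (K + #|I|%:R - 1 - k.*2%:R).

(** Distinct [k] ask for distinct values of [c r], so every [r] is counted at most once. *)
Lemma sum_level_card (ks : seq nat) : uniq ks -> (\sum_(k <- ks) f k <= #|I|)%N.
Proof.
move=> ksU; rewrite /f /N.
under eq_bigr => k _ do rewrite -sum1dep_card big_mkcondr.
rewrite exchange_big /= -[X in (_ <= X)%N]sum1_card; apply: leq_sum => r rI.
rewrite -big_mkcond /= sum1_count.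
have [/hasP[k kks /eqP ck]|] := boolP (has (fun k => c r == K + #|I|%:R - 1 - k.*2%:R) ks).
  rewrite (eq_count (a2 := pred1 k)) ?count_uniq_mem ?leq_b1 // => l /=.
  by rewrite ck; apply/eqP/eqP => [|->//]; lia.
by rewrite has_count -leqNgt leqn0 => /eqP->.
Qed.

(** The [f k] vertices at level [t - 1] are forced into [M] and those at level [t + 1] out of it;
    the inequalities leave room for a set of size [k] in between. For positive [k] the latter number
    [f k.-1]; for [k = 0] the upper bound is trivial, whence the guard. *)
Lemma signs_of_level (k : nat) : (k <= #|I|)%N -> (f k <= k)%N ->
  ((0 < k)%N -> (f k.-1 + k <= #|I|)%N) ->
  exists2 M : {set V}, M \subset I & #|M| = k /\
    forall r, r \in I -> c r + sg (r \notin M) <> K + #|I|%:R - k.*2%:R.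
Proof.
move=> kI fk fk1; pose t := K + #|I|%:R - k.*2%:R.
have [||M [AM MB Mk]] := @subset_of_card V [set r in I | c r == t - 1]
   [set r in I | c r != t + 1] k.
- by apply/subsetP => r; rewrite !inE => /andP[-> /eqP->] /=; lia.
- apply/andP; split.
    suff -> : t - 1 = K + #|I|%:R - 1 - k.*2%:R by [].
    by rewrite /t; lia.
  have -> : #|[set r in I | c r != t + 1]| = (#|I| - N (t + 1))%N.
    have := cardsID [set r | c r == t + 1] I.
    rewrite -[X in (X + _)%N]/(#|_|) /N => <-.
    have -> : I :&: [set r | c r == t + 1] = [set r in I | c r == t + 1].
      by apply/setP => r; rewrite !inE.
    rewrite addKn; apply: eq_card => r; by rewrite !inE andbC.
  have [k0|k0] := posnP k; first by rewrite k0.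
  have -> : t + 1 = K + #|I|%:R - 1 - k.-1.*2%:R by rewrite /t; lia.
  by have := fk1 k0; rewrite /f; lia.
exists M; first by apply: subset_trans MB _; apply/subsetP => r; rewrite inE => /andP[].
split=> // r rI; rewrite -/t; have [rM|rM] := boolP (r \in M) => /=.
  by have := subsetP MB r rM; rewrite inE rI /= /sg; lia.
have : r \notin [set r in I | c r == t - 1] by apply: contra rM; apply: (subsetP AM).
by rewrite inE rI /= /sg; lia.
Qed.

(** The least [k] with [f k <= k] is tried first. If it fails, [f k.-1] is very large: for [k = 1]
    or [2] the next levels are then empty and [k + 1] works, while for [k >= 3] the three levels
    below [k] together would exceed [#|I|]. *)
Lemma signs_exist : (1 < #|I|)%N ->
  exists2 M : {set V}, M \subset I &
    forall r, r \in I -> c r + sg (r \notin M) <> K + #|I|%:R - #|M|.*2%:R.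
Proof.
move=> I2.
suff [k [kI fk fk1]] : exists k, [/\ (k <= #|I|)%N, (f k <= k)%N &
    (0 < k)%N -> (f k.-1 + k <= #|I|)%N].
  by have [M MI [Mk MP]] := signs_of_level kI fk fk1; exists M => // r /MP; rewrite Mk.
have S2 i j : i != j -> (f i + f j <= #|I|)%N.
  by move=> ij; have := @sum_level_card [:: i; j]; rewrite !big_cons big_nil /= inE ij /= addn0; apply.
have S3 i j k : [&& i != j, i != k & j != k] -> (f i + f j + f k <= #|I|)%N.
  move=> ijk; have := @sum_level_card [:: i; j; k].
  rewrite !big_cons big_nil /= !inE negb_or addn0 addnA; apply.
  by case/and3P: ijk => -> -> ->.
have fI k : (f k <= #|I|)%N.
  by rewrite subset_leq_card //; apply/subsetP => r; rewrite inE => /andP[].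
have ex : exists k, (f k <= k)%N by exists #|I|.
case: (ex_minnP ex) => k fk kmin.
have kI : (k <= #|I|)%N by apply: kmin.
have low j : (j < k)%N -> (j < f j)%N.
  by move=> jk; rewrite ltnNge; apply/negP => /kmin; rewrite leqNgt jk.
case: k => [|[|[|k]]] in fk kmin kI low *.
- by exists 0%N.
- have [ok|bad] := leqP (f 0 + 1) #|I|; first by exists 1%N.
  have f1 := S2 0%N 1%N isT; have f2 := S2 0%N 2%N isT.
  by exists 2%N; split=> //= *; lia.
- have [ok|bad] := leqP (f 1 + 2) #|I|; first by exists 2%N.
  have f0 := low 0%N isT; have f1 := low 1%N isT.
  have f2 := S3 0%N 1%N 2%N isT; have f3 := S3 0%N 1%N 3%N isT.
  by exists 3%N; split=> /= *; lia.
- have [ok|bad] := leqP (f k.+2 + k.+3) #|I|; first by exists k.+3.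
  have f0 := low k.+1; have f1 := low k.
  have := S3 k k.+1 k.+2; lia.
Qed.

(** The candidates [h + 1], [h + 3], [h + 5], [h + 7] lie near half of [#|I|] and depend on disjoint
    pairs of levels. The value [t] excludes at most one; if the other three failed, each would have
    a level of nearly half of [I], too much in total. *)
Lemma signs_exist_avoiding (t : int) : (40 <= #|I|)%N ->
  exists2 M : {set V}, M \subset I &
    K + #|I|%:R - #|M|.*2%:R <> t /\
    forall r, r \in I -> c r + sg (r \notin M) <> K + #|I|%:R - #|M|.*2%:R.
Proof.
move=> I20; pose h := (#|I|./2 - 4)%N.
suff [k [kI fk fk1 kt]] : exists k, [/\ (k <= #|I|)%N, (f k <= k)%N,
    (0 < k)%N -> (f k.-1 + k <= #|I|)%N & K + #|I|%:R - k.*2%:R <> t].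
  have [M MI [Mk MP]] := signs_of_level kI fk fk1.
  by exists M => //; rewrite Mk; split.
have S : (\sum_(k <- [seq (h + i)%N | i <- iota 0 8]) f k <= #|I|)%N.
  by apply: sum_level_card; rewrite map_inj_uniq ?iota_uniq // => i j; lia.
rewrite big_map /= !big_cons big_nil addn0 in S.
pose ok k := [&& (f k <= k)%N, (f k.-1 + k <= #|I|)%N & K + #|I|%:R - k.*2%:R != t].
suff [k kh /and3P[fk fk1 kt]] : exists2 k, (k <= h + 7)%N & ok k.
  by exists k; split=> //; [rewrite /h in kh; lia | apply/eqP].
have [?|b1] := boolP (ok (h + 1)%N); first by exists (h + 1)%N; lia.
have [?|b3] := boolP (ok (h + 3)%N); first by exists (h + 3)%N; lia.
have [?|b5] := boolP (ok (h + 5)%N); first by exists (h + 5)%N; lia.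
have [?|b7] := boolP (ok (h + 7)%N); first by exists (h + 7)%N; lia.
exfalso; move: b1 b3 b5 b7; rewrite /ok.
rewrite !addnS !addn0 /= in S *.
move: (f h) (f h.+1) (f h.+2) (f h.+3) (f h.+4) (f h.+4.+1) (f h.+4.+2) (f h.+4.+3) S.
rewrite /h; lia.
Qed.

End Signs.

(** * Assembling the weighting *)

(* [a u v] stands for the weight of the edge minus 2; in a regular graph the
   sums of the weights and of the offsets differ by a constant. *)
Definition colourable (V : finType) (e : rel V) : Prop :=
  exists a : V -> V -> int,
    [/\ forall u v, a u v = a v u, forall u v, ~~ e u v -> a u v = 0%R,
        forall u v, (-1 <= a u v <= 1)%R &
        forall u v, e u v -> (\sum_w a u w)%R <> (\sum_w a v w)%R].

Lemma odd_sum_par (V : finType) (x : V -> int) :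
  (forall u, (-1 <= x u <= 1)%R) ->
  odd (absz (\sum_u x u)%R) = \big[addb/false]_u (x u != 0%R).
Proof.
move=> x1; apply: (big_ind2 (fun y b => odd (absz y) = b)) => //.
  by move=> y b z b' <- <-; lia.
by move=> u _; have := x1 u; case: eqP => [->//|]; lia.
Qed.

Section Assembly.
Local Open Scope ring_scope.
Variables (V : finType) (e : rel V).
Hypotheses (e_sym : symmetric e) (e_irr : irreflexive e).

(** The sum at a vertex [u] of the even set: an odd edge carries the sign of its other end, an edge
    inside the even set its offset [t]. *)
Definition rval (s : V -> bool) (j : rel V) (t : V -> V -> int) (u : V) : int :=
  \sum_w (if j u w then sg (s w) else t u w).

(* Vertices outside [E] end up odd, positive on one side of the cut and
   negative on the other, and those of [E] even; so conflicts can only occur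
   inside [E]. *)
Lemma assembly (E : {set V}) : exists s : V -> bool,
  forall (j : rel V) (t : V -> V -> int),
  symmetric j -> (forall u v, j u v -> e u v && ((u \in E) != (v \in E))) ->
  (forall u v, t u v = t v u) ->
  (forall u v, ~~ [&& e u v, u \in E & v \in E] -> t u v = 0) ->
  (forall u v, -1 <= t u v <= 1) ->
  (forall u, u \notin E -> par j u) ->
  (forall u, u \in E -> par j u = \big[addb/false]_w (t u w != 0)) ->
  (forall u v, u \in E -> v \in E -> e u v -> rval s j t u <> rval s j t v) ->
  colourable e.
Proof.
pose g : rel V := fun u v => [&& e u v, u \notin E & v \notin E].
have g_sym : symmetric g by move=> u v; rewrite /g e_sym; case: (u \in E); case: (v \in E).
have g_irr : irreflexive g by move=> u; rewrite /g e_irr.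
have [s sP] := two_sided_colouring g_sym g_irr.
exists s => j t j_sym jP t_sym t0 t1 parN parE valE.
pose beta u := #|[set w | j u w]|.
have [a [m [a_sym a0 a1 aS am]]] := sP beta.
(* The sign is read at the end outside [E], so all odd edges at such a vertex share one sign and add
   up without cancellation. *)
pose b u v := if j u v then sg (s (if u \in E then v else u)) else t u v.
have sg1 x : -1 <= sg x <= 1 by case: x.
have bE u v : u \notin E -> v \notin E -> b u v = 0.
  move=> uE vE; rewrite /b; case: ifP => [/jP|_].
    by rewrite (negbTE uE) (negbTE vE) andbF.
  by rewrite t0 // (negbTE uE) andbF.
have sumE u : u \in E -> \sum_w (a u w + b u w) = rval s j t u.
  move=> uE; apply: eq_bigr => w _; rewrite a0 ?add0r /b ?uE //.
  by rewrite /g uE andbF.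
have sumN u : u \notin E -> \sum_w (a u w + b u w) = sg (s u) * (beta u + (m u).*2)%N%:R.
  move=> uE; rewrite big_split /= aS.
  have -> : \sum_w b u w = sg (s u) * (beta u)%:R.
    rewrite /beta -sum1_card natr_sum mulr_sumr [RHS]big_mkcond /=.
    apply: eq_bigr => w _; rewrite /b inE (negbTE uE); case: ifP => [_|_]; first by rewrite mulr1.
    by rewrite t0 // (negbTE uE) andbF.
  by case: (s u); rewrite /sg; lia.
have oddN u : u \notin E -> odd (beta u) by move=> /parN; rewrite par_card.
have evenE u : u \in E -> ~~ odd (absz (rval s j t u)).
  move=> uE; rewrite odd_sum_par => [|w]; last by case: ifP.
  have -> : \big[addb/false]_w ((if j u w then sg (s w) else t u w) != 0) =
      par j u (+) \big[addb/false]_w (t u w != 0).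
    rewrite /par -big_split /=; apply: eq_bigr => w _.
    case: ifP => [/jP/andP[_ uw]|_ //]; rewrite t0 ?eqxx; first by case: (s w).
    by move: uw; rewrite uE; case: (w \in E) => //; rewrite !andbF.
  by rewrite parE // addbb.
exists (fun u v => a u v + b u v); split.
- move=> u v; rewrite a_sym /b j_sym t_sym; case: ifP => // /jP/andP[_ uv].
  by congr (_ + sg (s _)); move: uv; case: (u \in E); case: (v \in E).
- move=> u v nuv; rewrite a0 ?add0r /b /g ?(negbTE nuv) //.
  by case: ifP => [/jP|_]; rewrite ?t0 ?(negbTE nuv).
- move=> u v; have [guv|nguv] := boolP (g u v).
    by case/and3P: guv => _ uE vE; rewrite bE ?addr0.
  by rewrite a0 // add0r /b; case: ifP.
move=> u v euv; have [uE|uE] := boolP (u \in E); have [vE|vE] := boolP (v \in E).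
- by rewrite !sumE //; apply: valE.
- rewrite sumE // sumN //; have := evenE u uE; have := oddN v vE.
  by case: (s v); rewrite /sg; lia.
- rewrite [in RHS]sumE // sumN //; have := evenE v vE; have := oddN u uE.
  by case: (s u); rewrite /sg; lia.
rewrite !sumN //; have := oddN v vE; have := oddN u uE.
have : s u = s v -> (beta u + (m u).*2)%N <> (beta v + (m v).*2)%N.
  by move=> suv; apply: am => //; rewrite /g euv uE.
by case: (s u); case: (s v); rewrite /sg; lia.
Qed.

Definition side_sum (s : V -> bool) (j : rel V) (u : V) : int :=
  \sum_w (if j u w then sg (s w) else 0).

(** Later used to move a vanishing sum at [r] to [2] or [-2] without changing the parity at [r]. *)
Lemma side_sum_toggle (s : V -> bool) (i j : rel V) (r y z : V) : y != z ->
  (forall w, j r w = i r w (+) ((w == y) || (w == z))) -> s y = s z -> i r y = i r z ->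
  side_sum s j r = side_sum s i r + (if i r y then -1 else 1) * sg (s y) *+ 2.
Proof.
move=> yz jE sE iE; rewrite /side_sum.
rewrite (bigD1 y) //= (bigD1 z) 1?eq_sym //= [\sum_w (if i r w then _ else _)](bigD1 y) //=.
rewrite [\sum_(w | w != y) (if i r w then _ else _)](bigD1 z) 1?eq_sym //=.
rewrite !jE !eqxx orbT -iE -sE /=.
have -> : \sum_(w | (w != y) && (w != z)) (if j r w then sg (s w) else 0) =
          \sum_(w | (w != y) && (w != z)) (if i r w then sg (s w) else 0).
  by apply: eq_bigr => w /andP[/negbTE wy /negbTE wz]; rewrite jE wy wz addbF.
move: (\sum_(w | _) _) => S; case: (i r y) => /=; case: (s y); rewrite /sg; lia.
Qed.

Lemma edge_at (x y w : V) : x != y -> edge x y x w = (w == y).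
Proof. by move=> xy; rewrite /edge eqxx (negbTE xy) orbF. Qed.

(* [x] is even like the vertices of [R]; its odd edges go to [Y] and [I], and
   those to [M] carry a minus sign. *)
Lemma exceptional_assembly (R : {set V}) (x : V) :
  x \notin R -> (forall u v, u \in R -> v \in R -> ~~ e u v) ->
  exists s : V -> bool, forall (j : rel V) (Y I M : {set V}),
  symmetric j ->
  (forall u v, j u v -> [&& e u v, (u \in R) != (v \in R), u != x & v != x]) ->
  Y \subset [set y | e x y && (y \notin R)] ->
  I \subset [set y | e x y && (y \in R)] -> M \subset I ->
  (forall v, v != x -> par j v = ((v \notin R) && (v \notin Y)) || (v \in I)) ->
  ~~ odd (#|Y| + #|I|) ->
  (forall r, r \in R -> e x r ->
     side_sum s j r + (if r \in I then sg (r \notin M) else 0) <>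
     \sum_(y in Y) sg (s y) + #|I|%:R - #|M|.*2%:R) ->
  colourable e.
Proof.
move=> xR Rind; have [s sP] := assembly (x |: R).
exists s => j Y I M j_sym jP /subsetP YP /subsetP IP MI jpar YI valP.
have xY : x \notin Y by apply/negP => /YP; rewrite inE e_irr.
have xI : x \notin I by apply/negP => /IP; rewrite inE e_irr.
(* Edges from [x] to [Y] leave the even set and join the odd subgraph; those from [x] to [I] stay
   inside it and are put into [t]. *)
pose j1 : rel V := fun u v => [|| j u v, (u == x) && (v \in Y) | (v == x) && (u \in Y)].
pose t u v : int := if (u == x) && (v \in I) then sg (v \notin M) else
   if (v == x) && (u \in I) then sg (u \notin M) else 0.
have jx v : j x v = false by apply/negP => /jP; rewrite eqxx !andbF.
have jx' v : j v x = false by rewrite j_sym.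
have j1N u : u != x -> j1 u =1 xor_rel j (fun u v => (u \in Y) && (v == x)) u.
  move=> ux v; rewrite /j1 /xor_rel (negbTE ux) /= [(u \in Y) && _]andbC.
  by have [->|] := eqVneq v x; rewrite ?jx' //= ?orbF ?addbF.
have parY u : par (fun u v => (u \in Y) && (v == x)) u = (u \in Y).
  exact: (par_single (fun=> u \in Y)).
have j1x : j1 x =1 fun v => v \in Y.
  by move=> v; rewrite /j1 jx eqxx (negbTE xY) andbF orbF.
have tN u v : u != x -> t u v = if (u \in I) && (v == x) then sg (u \notin M) else 0.
  by move=> ux; rewrite /t (negbTE ux) /= andbC.
have tx v : t x v = if v \in I then sg (v \notin M) else 0.
  by rewrite /t eqxx /= (negbTE xI) andbF.
have sg0 b : sg b != 0 by case: b.
have sumI : \sum_(r in I) sg (r \notin M) = #|I|%:R - #|M|.*2%:R.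
  rewrite (bigID (mem M)) /=.
  rewrite (eq_bigr (fun=> -1)) => [|r /andP[_ ->] //].
  rewrite [X in _ + X](eq_bigr (fun=> 1)) => [|r /andP[_ ->] //].
  rewrite !sumr_const.
  have -> : #|[pred r in I | r \in M]| = #|M|.
    by apply: eq_card => r; rewrite inE andbC; apply: andb_idr; apply: (subsetP MI).
  have := cardsID M I; rewrite (setIidPr MI) => <-.
  have -> : #|[pred r in I | r \notin M]| = #|I :\: M|.
    by apply: eq_card => r; rewrite !inE andbC.
  lia.
have rvalN u : u \in R -> rval s j1 t u =
    side_sum s j u + (if u \in I then sg (u \notin M) else 0).
  move=> uR; have ux : u != x by apply: contraNneq xR => <-.
  have uY : u \notin Y by apply/negP => /YP; rewrite inE uR andbF.
  rewrite /rval /side_sum (bigD1 x) //= [in RHS](bigD1 x) //=.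
  rewrite j1N // /xor_rel jx' (negbTE uY) /= tN // eqxx andbT add0r addrC.
  congr (_ + _); apply: eq_bigr => w wx.
  by rewrite j1N // /xor_rel (negbTE uY) addbF tN // (negbTE wx) andbF.
have rvalx : rval s j1 t x = \sum_(y in Y) sg (s y) + #|I|%:R - #|M|.*2%:R.
  rewrite -addrA -sumI /rval [\sum_(y in Y) _]big_mkcond [\sum_(y in I) _]big_mkcond.
  rewrite -big_split /=; apply: eq_bigr => w _; rewrite j1x tx.
  case: ifP => wY; last by rewrite add0r.
  have /negbTE-> : w \notin I; last by rewrite addr0.
  by apply/negP => /IP; have := YP w wY; rewrite !inE => /andP[_ /negbTE->]; rewrite andbF.
apply: (sP j1 t).
- by move=> u v; rewrite /j1 j_sym orbC [(v == x) && _ || _]orbC orbC.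
- move=> u v /or3P[/jP/and4P[-> uv ux vx]|/andP[/eqP-> /YP]|/andP[/eqP-> /YP]].
  + by rewrite !inE (negbTE ux) (negbTE vx).
  + rewrite !inE eqxx /= => /andP[exv vR]; rewrite exv (negbTE vR) orbF.
    by have -> : (v == x) = false by apply: contraTF exv => /eqP->; rewrite e_irr.
  + rewrite !inE eqxx /= => /andP[exv vR]; rewrite e_sym exv (negbTE vR) orbF.
    by have -> : (u == x) = false by apply: contraTF exv => /eqP->; rewrite e_irr.
- move=> u v; rewrite /t; have [->|ux] := eqVneq u x; have [->|vx] := eqVneq v x => //=.
- move=> u v; rewrite /t; apply: contraNeq.
  case: ifP => [/andP[/eqP-> /IP]|_].
    by rewrite !inE eqxx => /andP[-> ->]; rewrite orbT.
  case: ifP => [/andP[/eqP-> /IP]|_]; last by rewrite eqxx.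
  by rewrite !inE eqxx e_sym => /andP[-> ->]; rewrite orbT.
- by move=> u v; rewrite /t; do 2?case: ifP => // _; case: (_ \notin _).
- move=> u; rewrite !inE negb_or => /andP[ux uR].
  rewrite (eq_par (j1N u ux)) par_xor parY jpar // uR /=.
  have /negbTE-> : u \notin I by apply: contra uR => /IP; rewrite inE => /andP[].
  by case: (u \in Y).
- move=> u; have [-> _|ux] := eqVneq u x.
    have parC (A : {set V}) : \big[addb/false]_w (w \in A) = odd #|A|.
      by rewrite -[LHS]/(par (fun _ w => w \in A) x) par_card cardsE.
    transitivity (odd #|Y|); first by rewrite -parC; apply: eq_bigr => w _; apply: j1x.
    transitivity (odd #|I|).
      by move: YI; rewrite oddD; case: (odd #|Y|); case: (odd #|I|).
    by rewrite -parC; apply: eq_bigr => w _; rewrite tx; case: ifP => _; rewrite ?sg0 ?eqxx.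
  rewrite !inE (negbTE ux) /= => uR.
  rewrite (eq_par (j1N u ux)) par_xor parY jpar // uR /=.
  have /negbTE-> : u \notin Y by apply/negP => /YP; rewrite inE uR andbF.
  rewrite addbF (eq_bigr (fun w => (u \in I) && (w == x))) => [|w _].
    by rewrite (par_single (fun=> u \in I)).
  by rewrite tN //; case: ifP => _; rewrite ?sg0 ?eqxx.
move=> u v; rewrite !inE => /orP[/eqP->|uR] /orP[/eqP->|vR]; first by rewrite e_irr.
- by move=> exv; rewrite rvalx rvalN // => /esym; apply: valP.
- by rewrite e_sym => exu; rewrite rvalx rvalN //; apply: valP.
by rewrite (negbTE (Rind u v uR vR)).
Qed.

End Assembly.

(** * Large independent sets linked by crossing edges *)

Section Reachability.
Variables (V : finType) (H : rel V).

Lemma connect_closed (D : {set V}) x y :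
  (forall u v, H u v -> u \in D -> v \in D) -> connect H x y -> x \in D -> y \in D.
Proof.
move=> HD /connectP[p]; elim: p x => [|z p IHp] x /= => [_ -> //|].
by case/andP=> xz zp yE xD; apply: (IHp z) => //; apply: HD xz xD.
Qed.

Lemma exists_distance root : symmetric H -> (forall x, connect H root x) ->
  exists dist : V -> nat,
  [/\ dist root = 0, forall x, x != root -> exists2 z, H x z & dist z < dist x &
      forall x z, H x z -> dist z <= (dist x).+1].
Proof.
move=> H_sym conn.
have ex x : exists n, [exists p : n.-tuple V, path H root p && (last root p == x)].
  have /connectP[p rp ->] := conn x.
  by exists (size p); apply/existsP; exists (in_tuple p); rewrite rp eqxx.
pose dist x := ex_minn (ex x).
have distP p : path H root p -> dist (last root p) <= size p.
  move=> rp; rewrite /dist; case: ex_minnP => m _; apply.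
  by apply/existsP; exists (in_tuple p); rewrite rp eqxx.
have distE x : exists p, [/\ path H root p, last root p = x & size p = dist x].
  rewrite /dist; case: ex_minnP => m /existsP[p /andP[rp /eqP px]] _.
  by exists p; split=> //; rewrite size_tuple.
exists dist; split.
- by apply/eqP; rewrite -leqn0; apply: (distP [::]).
- move=> x xr; have [p [rp px pd]] := distE x.
  case/lastP: p => [|p z] in rp px pd; first by rewrite -px eqxx in xr.
  move: rp px pd; rewrite rcons_path last_rcons size_rcons => /andP[rp pz] <- <-.
  by exists (last root p); rewrite 1?H_sym // ltnS distP.
move=> x z xz; have [p [rp px <-]] := distE x.
have := distP (rcons p z); rewrite last_rcons size_rcons rcons_path rp px xz.
exact.
Qed.

End Reachability.

Section Regular.
Variables (V : finType) (e : rel V) (d : nat).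
Hypotheses (e_sym : symmetric e) (e_irr : irreflexive e).
Hypothesis e_reg : forall v, #|[set u | e v u]| = d.
Hypothesis d_large : 50 <= d.
Hypothesis e_conn : forall x y, connect e x y.

Lemma neighbour_outside v (A : {set V}) : #|A| < d -> exists2 u, e v u & u \notin A.
Proof.
move=> Ad; have /subsetPn[u] : ~~ ([set u | e v u] \subset A).
  by apply: contraL Ad => /subset_leq_card; rewrite e_reg -leqNgt.
by rewrite inE; exists u.
Qed.

Definition crossing (R : {set V}) : rel V :=
  fun u v => e u v && ((u \in R) != (v \in R)).

Lemma crossing_sym R : symmetric (crossing R).
Proof. by move=> u v; rewrite /crossing e_sym eq_sym. Qed.

Lemma crossing_irr R : irreflexive (crossing R).
Proof. by move=> u; rewrite /crossing e_irr. Qed.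

Definition linked (R : {set V}) :=
  [forall x in R, forall y in R, ~~ e x y && connect (crossing R) x y].

Lemma linkedI (R : {set V}) h : (forall x y, x \in R -> y \in R -> ~~ e x y) ->
  (forall x, x \in R -> connect (crossing R) x h) -> linked R.
Proof.
move=> Rind Rh; apply/forall_inP => x xR; apply/forall_inP => y yR.
rewrite Rind //=; apply: connect_trans (Rh x xR) _.
by rewrite (sym_connect_sym (crossing_sym R)); apply: Rh.
Qed.

(** * Domination and private neighbours for a maximum linked set *)

Section MaximumLinked.
Variable R : {set V}.
Hypothesis R_linked : linked R.
Hypothesis R_max : forall Q, linked Q -> #|Q| <= #|R|.
Variable r0 : V.
Hypothesis r0R : r0 \in R.

Let H := crossing R.

Lemma linked_independent x y : x \in R -> y \in R -> ~~ e x y.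
Proof. by move=> xR yR; have /forall_inP/(_ x xR)/forall_inP/(_ y yR)/andP[] := R_linked. Qed.

Lemma linked_connect x y : x \in R -> y \in R -> connect H x y.
Proof. by move=> xR yR; have /forall_inP/(_ x xR)/forall_inP/(_ y yR)/andP[] := R_linked. Qed.

Lemma crossingE x y : e x y -> x \in R -> H x y.
Proof.
move=> exy xR; rewrite /H /crossing exy xR /=.
by apply: contraL exy => /eqP/esym yR; apply: linked_independent.
Qed.

(** Otherwise connectedness of the graph gives an edge from a dominated [b] to an undominated [w].
    Adding [w] to [R] preserves independence, and [w] is linked to a root of [b] through [b],
    against maximality. *)
Lemma maximum_linked_dominating v : v \notin R -> exists2 r, r \in R & e v r.
Proof.
move=> vR; pose D := [set u | (u \in R) || [exists r in R, e u r]].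
suff: v \in D by rewrite inE (negbTE vR) => /exists_inP[r rR vr]; exists r.
apply: connect_closed (e_conn r0 v) _; last by rewrite inE r0R.
move=> b w ebw bD; apply: contraT => wD.
have wR : w \notin R by apply: contra wD; rewrite inE => ->.
have wN x : x \in R -> ~~ e w x.
  by move=> xR; apply: contra wD => ewx; rewrite inE; apply/orP; right; apply/exists_inP; exists x.
have bR : b \notin R by apply: contraL ebw => /wN; rewrite e_sym.
move: bD; rewrite inE (negbTE bR) => /exists_inP[r rR ebr].
(* No crossing edge meets [w], which has no neighbour in [R], so all of them survive. *)
have sub : subrel (connect H) (connect (crossing (w |: R))).
  apply: connect_sub => x y /andP[exy xy]; apply: connect1; rewrite /crossing exy /= !inE.
  have [xw|] := eqVneq x w; have [yw|] := eqVneq y w => //=.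
  - by move: xy; rewrite xw yw eqxx.
  - by move: xy; rewrite -{}xw in wN wR *; rewrite (negbTE wR); case: (boolP (y \in R)) => // /wN; rewrite exy.
  - move: xy; rewrite -{}yw in wN wR *; rewrite (negbTE wR); case: (boolP (x \in R)) => // /wN.
    by rewrite e_sym exy.
have /negbTE bw : b != w by apply: contraTneq ebw => ->; rewrite e_irr.
suff /R_max : linked (w |: R) by rewrite cardsU1 wR ltnn.
apply: (@linkedI _ r) => [x y|x]; rewrite !inE.
  case/orP=> [/eqP->|xR] /orP[/eqP->|yR]; rewrite ?e_irr ?wN //.
    by rewrite e_sym wN.
  exact: linked_independent.
case/orP=> [/eqP->|xR]; last by apply: sub; apply: linked_connect.
apply: (@connect_trans _ _ b); apply: connect1; rewrite /crossing !inE ?eqxx.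
  by rewrite e_sym ebw (negbTE bR) bw.
by rewrite ebr rR (negbTE bR) bw orbT.
Qed.

Lemma crossing_connect x y : connect H x y.
Proof.
suff Hr z : connect H z r0.
  by apply: connect_trans (Hr x) _; rewrite (sym_connect_sym (crossing_sym R)).
have [zR|zR] := boolP (z \in R); first exact: linked_connect.
have [r rR zr] := maximum_linked_dominating zR.
apply: connect_trans (linked_connect rR r0R); apply: connect1.
by rewrite /H crossing_sym; apply: crossingE; rewrite // e_sym.
Qed.

Definition roots (b : V) : {set V} := [set r in R | e b r].

Definition private (r : V) : {set V} := [set b | e r b & #|roots b| == 1].

Lemma private_root r b x : b \in private r -> r \in R -> x \in R -> e b x -> x = r.
Proof.
rewrite inE => /andP[erb /eqP/eqP/cards1P[y by1]] rR xR ebx.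
have : x \in roots b by rewrite inE xR.
have : r \in roots b by rewrite inE rR e_sym.
by rewrite by1 !inE => /eqP-> /eqP.
Qed.

Lemma private_notin r b : r \in R -> b \in private r -> b \notin R.
Proof.
by move=> rR; rewrite inE => /andP[erb _]; apply: contraL erb; apply: linked_independent.
Qed.

(* Otherwise [r] could be exchanged for two non-adjacent private neighbours. *)
Lemma private_clique r : r \in R ->
  (forall x y, x \notin r |: private r -> y \notin r |: private r ->
     connect (fun u v => [&& H u v, u \notin r |: private r & v \notin r |: private r]) x y) ->
  forall p q, p \in private r -> q \in private r -> p != q -> e p q.
Proof.
move=> rR conn p q pP qP pq; apply: contraT => npq.
have [erp _] : e r p /\ #|roots p| == 1 by move: pP; rewrite inE => /andP[].
have [erq _] : e r q /\ #|roots q| == 1 by move: qP; rewrite inE => /andP[].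
have pR := private_notin rR pP; have qR := private_notin rR qP.
pose Q := p |: (q |: (R :\ r)).
have pr : p != r by apply: contraTneq erp => ->; rewrite e_irr.
have qr : q != r by apply: contraTneq erq => ->; rewrite e_irr.
have Qc : #|Q| = #|R|.+1.
  rewrite /Q !cardsU1 !inE (negbTE pq) (negbTE pR) (negbTE qR) !andbF /=.
  by rewrite [in RHS](cardsD1 r) rR !add1n.
have nR x z : z \in private r -> x \in R -> x != r -> ~~ e z x.
  by move=> zP xR; apply: contraNN => ezx; apply/eqP; apply: private_root zP rR xR ezx.
suff /R_max : linked Q by rewrite Qc ltnn.
have rQ : r \notin Q by rewrite !inE eqxx [r == p]eq_sym [r == q]eq_sym (negbTE pr) (negbTE qr).
have Qind x y : x \in Q -> y \in Q -> ~~ e x y.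
  rewrite !inE => /or3P[/eqP->|/eqP->|/andP[xr xR]] /or3P[/eqP->|/eqP->|/andP[yr yR]].
  - by rewrite e_irr.
  - by [].
  - exact: nR.
  - by rewrite e_sym.
  - by rewrite e_irr.
  - exact: nR.
  - by rewrite e_sym nR.
  - by rewrite e_sym nR.
  - exact: linked_independent.
apply: (@linkedI _ p) => // x xQ; have := xQ; rewrite !inE => /or3P[/eqP->|/eqP->|/andP[xr xR]].
- exact: connect0.
(* [r] is now outside the set and links [q] to [p]. *)
- apply: (@connect_trans _ _ r); apply: connect1; rewrite /crossing (negbTE rQ) !inE ?eqxx ?orbT.
    by rewrite e_sym erq.
  by rewrite erp.
have xX : x \notin r |: private r.
  by rewrite in_setU1 negb_or xr /=; apply/negP => /(private_notin rR); rewrite xR.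
(* If all [d] neighbours of [p] were in the star of [r], counting would make every neighbour of [r]
   private; the star would then be closed under [H], although [x] lies outside it. *)
have [b epb bX] : exists2 b, e p b & b \notin r |: private r.
  have [/existsP[b /andP[? ?]]|noX] := boolP [exists b, e p b && (b \notin r |: private r)].
    by exists b.
  case/negP: xX; apply: connect_closed (crossing_connect r x) _; last by rewrite !inE eqxx.
  have PN : private r = [set u | e r u].
    apply/eqP; rewrite eqEcard; apply/andP; split.
      by apply/subsetP => u; rewrite !inE => /andP[].
    rewrite e_reg -(e_reg p).
    have X1 : #|(r |: private r) :\ p|.+1 = #|r |: private r|.
      by rewrite [RHS](cardsD1 p) in_setU1 pP orbT.
    have X2 : #|r |: private r| <= #|private r|.+1.
      by rewrite cardsU1; case: (r \notin _).
    rewrite -ltnS (leq_trans _ X2) // -X1 ltnS subset_leq_card //.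
    apply/subsetP => u; rewrite inE => epu.
    have up : u != p by apply: contraTneq epu => ->; rewrite e_irr.
    by rewrite in_setD1 up /=; move: noX => /existsPn/(_ u); rewrite epu /= negbK.
  move=> u v /andP[euv uv]; rewrite !in_setU1 => /orP[/eqP ur|uP].
    by rewrite PN inE -ur euv orbT.
  have uR := private_notin rR uP; move: uv; rewrite (negbTE uR).
  by case: (boolP (v \in R)) => // vR _; rewrite (private_root uP rR vR euv) eqxx.
have bR : b \notin R.
  by apply: contra bX => bR; rewrite (private_root pP rR bR epb) !inE eqxx.
have bQ : b \notin Q.
  rewrite !inE (negbTE bR) andbF orbF; apply: contra bX.
  by case/orP=> /eqP->; rewrite in_setU1 ?pP ?qP orbT.
(* [b] is dominated but not private to [r], so it has a root other than [r]. *)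
have [r' r'R /andP[r'r ebr']] : exists2 r', r' \in R & (r' != r) && e b r'.
  have [y yR eby] := maximum_linked_dominating bR.
  have [yr|] := eqVneq y r; last by exists y; rewrite // -?yr ?eby ?andbT.
  have : 1 < #|roots b|.
    rewrite ltn_neqAle card_gt0; apply/andP; split.
      apply: contra bX => /eqP rb; rewrite in_setU1 inE -yr e_sym eby -rb orbT //.
    by apply/set0Pn; exists y; rewrite inE yR.
  rewrite (cardsD1 r) !inE -yr yR eby /= add1n ltnS card_gt0 => /set0Pn[z].
  by rewrite !inE => /and3P[zy zR ebz]; exists z; rewrite ?zy.
have r'X : r' \notin r |: private r.
  by rewrite in_setU1 negb_or r'r; apply/negP => /(private_notin rR); rewrite r'R.
have r'Q : r' \in Q by rewrite !inE r'r r'R !orbT.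
have pQ : p \in Q by rewrite !inE eqxx.
(* Off the star of [r] the sets [Q] and [R] agree, so the hypothesis links [x] to [r'], and [b]
   leads on to [p]. *)
apply: (@connect_trans _ _ r').
  apply: connect_sub (conn x r' xX r'X) => u v /and3P[/andP[euv uv] uX vX].
  apply: connect1; rewrite /crossing euv /=.
  have QE w : w \notin r |: private r -> (w \in Q) = (w \in R).
    rewrite in_setU1 negb_or => /andP[wr wP]; rewrite !inE wr /=.
    have /negbTE-> : w != p by apply: contraNneq wP => ->.
    by have /negbTE-> : w != q by apply: contraNneq wP => ->.
  by rewrite !QE.
apply: (@connect_trans _ _ b); apply: connect1; rewrite /crossing (negbTE bQ) ?r'Q ?pQ.
  by rewrite e_sym ebr'.
by rewrite e_sym epb.
Qed.

Lemma colourable_even : ~~ odd #|~: R| -> colourable e.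
Proof.
move=> ev; have [s sP] := assembly e_sym e_irr R.
have [|j [j_sym jH jp]] := @parity_join _ H setT (~: R) (crossing_sym R) (crossing_irr R) _ (subsetT _) ev.
  by move=> *; apply: crossing_connect.
apply: (sP j (fun _ _ => 0%R)) => //.
- by move=> u uR; rewrite jp inE.
- by move=> u uR; rewrite jp inE uR big1 // => w _; rewrite eqxx.
by move=> u v uR vR euv; have := linked_independent uR vR; rewrite euv.
Qed.

(** * Removing a farthest vertex, or a star containing it, from the crossing graph *)

Section Removal.
Variable dist : V -> nat.
Hypothesis dist_r0 : dist r0 = 0.
Hypothesis dist_step : forall x, x != r0 -> exists2 z, H x z & dist z < dist x.
Hypothesis dist_lip : forall x z, H x z -> dist z <= (dist x).+1.
Variable b : V.
Hypothesis bR : b \notin R.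
Hypothesis b_far : forall x, x \notin R -> dist x <= dist b.

Definition minus_vertex : rel V := fun u v => [&& H u v, u != b & v != b].

(** Descent towards [r0]. If the step from [z] leads to [b], then [z] is in [R], and any other
    neighbour of [z] is outside [R], hence no farther than [b] and still closer to [r0] than [z]. *)
Lemma farthest_removable x y : x != b -> y != b -> connect minus_vertex x y.
Proof.
have ms : symmetric minus_vertex.
  by move=> u v; rewrite /minus_vertex /H crossing_sym; case: (u == b); case: (v == b).
suff Hr z : z != b -> connect minus_vertex z r0.
  by move=> xb yb; apply: connect_trans (Hr x xb) _; rewrite (sym_connect_sym ms); apply: Hr.
have [n] := ubnP (dist z); elim: n z => // n IHn z zn zb.
have [->|zr] := eqVneq z r0; first exact: connect0.
suff [w /andP[Hzw wb] wz] : exists2 w, H z w && (w != b) & dist w < dist z.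
  apply: connect_trans (IHn w _ wb); last exact: leq_trans wz zn.
  by apply: connect1; rewrite /minus_vertex Hzw zb.
have [w Hzw wz] := dist_step zr; have [wb|wb] := eqVneq w b; last by exists w; rewrite ?Hzw.
have zR : z \in R by move: Hzw; rewrite wb => /andP[_]; rewrite (negbTE bR); case: (z \in R).
have [|w' ezw' w'b] := @neighbour_outside z [set b]; first by rewrite cards1 (leq_trans _ d_large).
exists w'; first by rewrite crossingE //; move: w'b; rewrite inE.
apply: leq_ltn_trans wz; rewrite wb b_far //.
by apply: contraL ezw'; apply: linked_independent.
Qed.

(** A descent to [r0] from outside the star never enters it. A vertex stepping down to [r] would be
    as far as [b], so it would have a single root and be private to [r]; a private neighbour is
    adjacent in [H] to [r] alone. *)
Lemma star_removable r : r \in R -> e b r ->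
  (forall x, x \notin R -> dist x = dist b -> #|roots x| = 1) ->
  forall x y, x \notin r |: private r -> y \notin r |: private r ->
  connect (fun u v => [&& H u v, u \notin r |: private r & v \notin r |: private r]) x y.
Proof.
move=> rR ebr far1; set X := r |: private r; set HX := fun u v => _.
have br : b != r by apply: contraNneq bR => ->.
have bP : b \in private r by rewrite inE e_sym ebr far1.
have bdist : dist b = (dist r).+1.
  have br0 : b != r0 by apply: contraNneq bR => ->.
  have [z Hbz zb] := dist_step br0.
  have zR : z \in R by move: Hbz => /andP[_]; rewrite (negbTE bR); case: (z \in R).
  have zr : z = r by apply: private_root bP rR zR _; case/andP: Hbz.
  have Hzb : H z b by rewrite /H crossing_sym.
  by apply/eqP; rewrite -zr eqn_leq zb dist_lip.
have XR x : x \in R -> x != r -> x \notin X.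
  by move=> xR xr; rewrite in_setU1 negb_or xr; apply/negP => /(private_notin rR); rewrite xR.
have near x z : x \notin X -> H x z -> z \in X -> dist z < dist x -> False.
  move=> xX /andP[exz xz]; rewrite in_setU1 => /orP[/eqP zr|zP] zx.
    have xR : x \notin R by move: xz; rewrite zr rR; case: (x \in R).
    case/negP: xX; rewrite in_setU1 inE -zr e_sym exz far1 ?orbT //.
    by apply/eqP; rewrite eqn_leq b_far //= bdist -zr.
  have xR : x \in R by move: xz; rewrite (negbTE (private_notin rR zP)); case: (x \in R).
  by case/negP: xX; rewrite (private_root zP rR xR) ?in_setU1 ?eqxx // e_sym.
(* If the star is centred at [r0] itself, it contains every vertex and nothing remains to be
   connected. *)
have [rr0|rr0] := eqVneq r r0.
  have BX x : x \notin R -> x \in X.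
    move=> xR; apply: contraT => xX.
    have xr0 : x != r0 by apply: contraNneq xR => ->.
    have [z Hxz zx] := dist_step xr0; exfalso; apply: (near x z) => //.
    have [->|zr0] := eqVneq z r0; first by rewrite -rr0 in_setU1 eqxx.
    have [w _ wz] := dist_step zr0.
    have := leq_trans zx (b_far xR); rewrite bdist rr0 dist_r0 ltnS leqn0.
    by move/eqP=> z0; rewrite z0 in wz.
  suff VX x : x \in X by move=> x y; rewrite VX.
  have [xR|] := boolP (x \in R); last exact: BX.
  have [|u exu _] := @neighbour_outside x set0; first by rewrite cards0 (leq_trans _ d_large).
  have uR : u \notin R by apply: contraL exu; apply: linked_independent.
  have := BX u uR; rewrite in_setU1 => /orP[/eqP ur|uP]; first by rewrite ur rR in uR.
  by rewrite (private_root uP rR xR) ?in_setU1 ?eqxx // e_sym.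
have HXs : symmetric HX.
  by move=> u v; rewrite /HX /H crossing_sym; case: (u \in X); case: (v \in X).
suff Hr z : z \notin X -> connect HX z r0.
  by move=> x y xX yX; apply: connect_trans (Hr x xX) _; rewrite (sym_connect_sym HXs); apply: Hr.
have [n] := ubnP (dist z); elim: n z => // n IHn z zn zX.
have [->|zr] := eqVneq z r0; first exact: connect0.
have [w Hzw wz] := dist_step zr.
have wX : w \notin X by apply/negP => wX; apply: near zX Hzw wX wz.
apply: connect_trans (IHn w _ wX); last exact: leq_trans wz zn.
by apply: connect1; rewrite /HX Hzw zX.
Qed.

End Removal.

(** * An odd complement: one vertex outside [R] is made even *)

Section Exceptional.
Local Open Scope ring_scope.
Variable b : V.
Hypothesis bR : b \notin R.
Hypothesis b_removable : forall x y, x != b -> y != b -> connect (minus_vertex b) x y.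
Hypothesis R_odd : odd #|~: R|.

(** Without [b] the complement of [R] has even size. Flipping the demand on [Y] and [I] anticipates
    the nonzero edges from [b], which are not part of [j]. *)
Lemma join_minus_vertex (Y I : {set V}) :
  Y \subset [set y | e b y && (y \notin R)] -> I \subset [set y | e b y && (y \in R)] ->
  ~~ odd (#|Y| + #|I|) ->
  exists j, [/\ symmetric j,
    forall u v, j u v -> [&& e u v, (u \in R) != (v \in R), u != b & v != b] &
    forall v, v != b -> par j v = ((v \notin R) && (v \notin Y)) || (v \in I)].
Proof.
move=> YP IP YI; pose B := ~: (b |: R).
have YB : Y \subset B.
  apply/subsetP => y /(subsetP YP); rewrite !inE negb_or => /andP[eby ->]; rewrite andbT.
  by apply: contraTneq eby => ->; rewrite e_irr.
have IR : I \subset R by apply/subsetP => y /(subsetP IP); rewrite inE => /andP[].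
have Bodd : ~~ odd #|B|.
  have := cardsD1 b (~: R); rewrite inE bR.
  have -> : (~: R) :\ b = B by apply/setP => v; rewrite !inE negb_or.
  by move=> E; move: R_odd; rewrite E.
pose T := (B :\: Y) :|: I.
have Tdisj : [disjoint B :\: Y & I].
  rewrite disjoints_subset; apply/subsetP => v; rewrite !inE negb_or.
  by case/and3P=> _ _ vR; apply: contra vR; apply: (subsetP IR).
have Tc : #|T| = (#|B| - #|Y| + #|I|)%N.
  by rewrite /T cardsU (disjoint_setI0 Tdisj) cards0 subn0 cardsD (setIidPr YB).
have := subset_leq_card YB => YBc.
have [||||| j [j_sym jH jp]] := @parity_join _ (minus_vertex b) (~: [set b]) T.
- by move=> u v; rewrite /minus_vertex /H crossing_sym; case: (u == b); case: (v == b).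
- by move=> u; rewrite /minus_vertex /H crossing_irr.
- by move=> x y; rewrite !inE; apply: b_removable.
- apply/subsetP => v; rewrite !inE negb_or => /orP[/and3P[]//|/(subsetP IR)].
  by apply: contraTneq => ->.
- by move: YI; rewrite Tc !oddD oddB // (negbTE Bodd).
exists j; split=> // [u v /jH/and3P[/andP[-> ->] -> ->] //|v vb].
by rewrite jp !inE negb_or vb /= andbC.
Qed.

Lemma colourable_signs : (1 < #|roots b|)%N -> colourable e.
Proof.
move=> rb; have [s sP] := exceptional_assembly e_sym e_irr bR linked_independent.
have rootsP : roots b \subset [set y | e b y && (y \in R)].
  by apply/subsetP => r; rewrite !inE andbC.
(* With evenly many roots, signs on all edges from [b] to [R] keep [b] even. *)
have [oddr|evenr] := boolP (odd #|roots b|); last first.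
  have [|||j [j_sym jP jp]] := @join_minus_vertex set0 (roots b).
  - exact: sub0set.
  - exact: rootsP.
  - by rewrite cards0.
  have [M MI MP] := signs_exist (side_sum s j) 0 rb.
  apply: (sP j set0 (roots b) M) => //; [exact: sub0set| by rewrite cards0|].
  by move=> r rR ebr; rewrite big_set0 !inE rR ebr; apply: MP; rewrite inE rR.
(* With oddly many roots, one odd edge from [b] to a vertex [y] outside [R] corrects the parity at
   [b]. *)
have [/existsP[y eby]|noy] := boolP [exists y, e b y && (y \notin R)].
  have Y1 : [set y] \subset [set y | e b y && (y \notin R)] by rewrite sub1set inE.
  have ev : ~~ odd (#|[set y]| + #|roots b|) by rewrite cards1 /= oddr.
  have [j [j_sym jP jp]] := join_minus_vertex Y1 rootsP ev.
  have [M MI MP] := signs_exist (side_sum s j) (sg (s y)) rb.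
  apply: (sP j [set y] (roots b) M) => //.
  by move=> r rR ebr; rewrite big_set1 !inE rR ebr; apply: MP; rewrite inE rR.
(* Here all neighbours of [b] are in [R] and [d] is odd. The edge to one root [r1] keeps offset
   zero, so the sum at [b] must also avoid the fixed sum at [r1]. *)
have rootsd : #|roots b| = d.
  rewrite -(e_reg b); apply: eq_card => v; rewrite !inE andbC; apply: andb_idr => ebv.
  by move: noy => /existsPn/(_ v); rewrite ebv negbK.
have /card_gt0P[r1 r1b] : (0 < #|roots b|)%N by apply: ltnW.
have cI : #|roots b| = (#|roots b :\ r1|).+1 by rewrite (cardsD1 r1) r1b.
have Isub : roots b :\ r1 \subset [set y | e b y && (y \in R)].
  exact: subset_trans (subD1set _ _) rootsP.
have [||j [j_sym jP jp]] := @join_minus_vertex set0 (roots b :\ r1) _ Isub.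
- exact: sub0set.
- by move: oddr; rewrite cards0 cI.
have [|M MI [Mt MP]] := signs_exist_avoiding (side_sum s j) 0 (side_sum s j r1) (I := roots b :\ r1).
  by rewrite -ltnS -cI rootsd (leq_trans _ d_large).
apply: (sP j set0 (roots b :\ r1) M) => //; first exact: sub0set.
  by move: oddr; rewrite cards0 cI.
move=> r rR ebr; rewrite big_set0; have [->|rr1] := eqVneq r r1.
  by rewrite !inE eqxx /= addr0 => /esym.
have rI : r \in roots b :\ r1 by rewrite !inE rr1 rR.
by rewrite rI; apply: MP.
Qed.

Lemma colourable_private (r : V) : r \in R -> b \in private r ->
  (forall x y, x \notin r |: private r -> y \notin r |: private r ->
     connect (fun u v => [&& H u v, u \notin r |: private r & v \notin r |: private r]) x y) ->
  colourable e.
Proof.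
move=> rR bP conn; have clique := private_clique rR conn.
have [s sP] := exceptional_assembly e_sym e_irr bR linked_independent.
have [|||j [j_sym jP jp]] := @join_minus_vertex set0 set0.
- exact: sub0set.
- exact: sub0set.
- by rewrite cards0.
have bond x : x \in R -> e b x -> x = r by apply: private_root.
have rb : r != b by apply: contraNneq bR => <-.
(* All offsets at [b] are zero for this [j], so there is a conflict only if [r] has sum zero too. *)
have [c0|c0] := eqVneq (side_sum s j r) 0; last first.
  apply: (sP j set0 set0 set0) => //; try exact: sub0set; first by rewrite cards0.
  move=> x xR ebx; rewrite (bond x xR ebx) inE big_set0 !cards0 addr0.
  by rewrite (_ : 0 + _ - _ = 0) //; apply/eqP.
have erE v : v \in private r -> e r v by rewrite inE => /andP[].
have jpR v : v != b -> par j v = (v \notin R) by move=> vb; rewrite jp // !inE andbT orbF.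
have crossr v : e r v -> v != b -> [&& e r v, (r \in R) != (v \in R), r != b & v != b].
  by move=> erv vb; have := crossingE erv rR; rewrite /H /crossing => /andP[-> ->]; rewrite rb.
have edgeP y u v : e r y -> y != b -> edge r y u v ->
    [&& e u v, (u \in R) != (v \in R), u != b & v != b].
  move=> ery yb; have /and4P[E1 E2 E3 E4] := crossr y ery yb.
  case/orP=> /andP[/eqP-> /eqP->]; first by rewrite E1 E2 E3 E4.
  by rewrite e_sym E1 eq_sym E2 E3 E4.
(* Of three private neighbours other than [b], two lie on one side of the cut; call them [y] and
   [z]. The odd edges [ry], [rz] are replaced by [by], [bz], which exist since private neighbours
   form a clique. This sends [r] and [b] to opposite values [2] and [-2]. *)
have [P4|P4] := leqP 4 #|private r|.
  have [|y [z [yP zP yz syz]]] := @pigeonhole V _ s (private r :\ b).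
    by rewrite card_bool; move: P4; rewrite (cardsD1 b) bP.
  move: yP zP; rewrite !in_setD1 => /andP[yb yP] /andP[zb zP].
  (* [r] is the only neighbour of [v] in [H], so the odd degree of [v] in [j] forces this edge. *)
  have jr v : v != b -> v \in private r -> j r v.
    move=> vb vP; have := jpR v vb; rewrite (private_notin rR vP) /par (bigD1 r) //=.
    rewrite big1 ?addbF 1?j_sym // => w wr; apply: contraNF wr => /jP/and4P[evw vw _ _].
    apply/eqP; apply: (private_root vP rR _ evw).
    by move: vw; rewrite (negbTE (private_notin rR vP)); case: (w \in R).
  have ry : r != y by apply: contraTneq (erE y yP) => <-; rewrite e_irr.
  have rz : r != z by apply: contraTneq (erE z zP) => <-; rewrite e_irr.
  pose j1 := xor_rel j (xor_rel (edge r y) (edge r z)).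
  have ey : e b y by rewrite clique // eq_sym.
  have ez : e b z by rewrite clique // eq_sym.
  have j1r w : j1 r w = j r w (+) ((w == y) || (w == z)).
    rewrite /j1 /xor_rel !edge_at //; congr (_ (+) _).
    by have [->|_] //= := eqVneq w y; rewrite (negbTE yz).
  apply: (sP j1 [set y; z] set0 set0).
  - by apply: xor_sym => //; apply: xor_sym; apply: edge_sym.
  - move=> u v; rewrite /j1 /xor_rel; have [/jP//|_] := boolP (j u v).
    have [/(edgeP y _ _ (erE y yP) yb)//|_] := boolP (edge r y u v).
    by rewrite !addFb => /(edgeP z _ _ (erE z zP) zb).
  - by rewrite subUset !sub1set !inE ey ez !(private_notin rR).
  - exact: sub0set.
  - exact: sub0set.
  - move=> v vb; rewrite /j1 !par_xor !par_edge // jpR // !inE orbF negb_or.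
    have [->|_] := eqVneq v y; first by rewrite (private_notin rR yP) (negbTE yz) /=; case: (y == r).
    have [->|_] := eqVneq v z; first by rewrite (private_notin rR zP) /=; case: (z == r).
    by rewrite !andbT !addbF addbb addbF.
  - by rewrite cards2 yz cards0.
  move=> x xR ebx; rewrite (bond x xR ebx) inE (side_sum_toggle yz j1r syz) ?jr // c0.
  rewrite big_setU1 ?inE ?(negbTE yz) //= big_set1 -syz !cards0 /=.
  by apply/eqP; case: (s y).
(* At most three neighbours of [r] are private, so more than four are not, and two of these agree in
   side and in membership of [j]. Toggling [rq], [rq'] and a path from [q] to [q'] off the star
   preserves all parities, moves [r] by two and leaves [b] at zero. *)
have [|q [q' [qA q'A qq' []]]] := @pigeonhole V _ (fun v => (s v, j r v)) ([set u | e r u] :\: private r).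
  rewrite card_prod !card_bool cardsD e_reg ltn_subRL.
  apply: (@leq_ltn_trans (3 + 4)); last exact: leq_trans d_large.
  by rewrite leq_add2r (leq_trans (subset_leq_card (subsetIr _ _))).
move=> sq jq; move: qA q'A; rewrite !in_setD => /andP[qP]; rewrite inE => erq /andP[q'P].
rewrite inE => erq'.
have qr : r != q by apply: contraTneq erq => <-; rewrite e_irr.
have q'r : r != q' by apply: contraTneq erq' => <-; rewrite e_irr.
have qb : q != b by apply: contraNneq qP => ->.
have q'b : q' != b by apply: contraNneq q'P => ->.
have qX : q \notin r |: private r by rewrite in_setU1 negb_or eq_sym qr.
have q'X : q' \notin r |: private r by rewrite in_setU1 negb_or eq_sym q'r.
have [||i [i_sym iH ip]] := path_join _ _ (conn q q' qX q'X).
- by move=> u v; rewrite /H crossing_sym; case: (u \in _); case: (v \in _).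
- by move=> u; rewrite /H crossing_irr.
pose j1 := xor_rel j (xor_rel i (xor_rel (edge r q) (edge r q'))).
have ir w : i r w = false by apply/negP => /iH/and3P[_]; rewrite in_setU1 eqxx.
have j1r w : j1 r w = j r w (+) ((w == q) || (w == q')).
  rewrite /j1 /xor_rel !edge_at // ir; congr (_ (+) _).
  by have [->|_] //= := eqVneq w q; rewrite (negbTE qq').
apply: (sP j1 set0 set0 set0).
- by do 2!apply: xor_sym => //; apply: xor_sym; apply: edge_sym.
- move=> u v; rewrite /j1 /xor_rel; have [/jP//|_] := boolP (j u v).
  have [/(edgeP q _ _ erq qb)//|_] := boolP (edge r q u v).
  have [/(edgeP q' _ _ erq' q'b)//|_] := boolP (edge r q' u v).
  rewrite !addFb !addbF => /iH/and3P[/andP[-> ->] uX vX].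
  by rewrite /=; apply/andP; split; [apply: contraNneq uX | apply: contraNneq vX] => ->; rewrite in_setU1 bP orbT.
- exact: sub0set.
- exact: sub0set.
- exact: sub0set.
- move=> v vb; rewrite /j1 !par_xor !par_edge // jpR // ip !inE andbT orbF.
  by case: (v == q); case: (v == q'); case: (v == r); rewrite /= ?addbF.
- by rewrite cards0.
move=> x xR ebx; rewrite (bond x xR ebx) inE (side_sum_toggle qq' j1r sq jq) // c0.
rewrite big_set0 !cards0 /=.
by apply/eqP; case: (j r q); case: (s q).
Qed.

End Exceptional.

Lemma colourable_odd : odd #|~: R| -> colourable e.
Proof.
move=> R_odd.
have [dist [dist_r0 dist_step dist_lip]] :=
  exists_distance (crossing_sym R) (crossing_connect r0).
have /card_gt0P[x xR] : 0 < #|~: R| by case: #|_| R_odd.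
rewrite inE in xR; have [b1 b1R far] := @arg_maxnP _ x (fun v => v \notin R) dist xR.
(* A farthest vertex with several roots is preferred; if there is none, all farthest vertices have
   exactly one root, as [star_removable] requires. *)
have [/existsP[b /and3P[bR /eqP bd rb]]|noroots] :=
    boolP [exists b, [&& b \notin R, dist b == dist b1 & 1 < #|roots b|]].
  apply: (colourable_signs bR) => //; apply: (farthest_removable dist_step bR).
  by move=> z zR; rewrite bd; apply: far.
have [r rR ebr] := maximum_linked_dominating b1R.
have far1 z : z \notin R -> dist z = dist b1 -> #|roots z| = 1.
  move=> zR zd; apply/eqP; rewrite eqn_leq; apply/andP; split.
    by move: noroots => /existsPn/(_ z); rewrite zR zd eqxx /= -leqNgt.
  have [r' r'R ezr'] := maximum_linked_dominating zR.
  by apply/card_gt0P; exists r'; rewrite inE r'R.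
apply: (@colourable_private b1 b1R _ R_odd r) => //.
- exact: (farthest_removable dist_step b1R).
- by rewrite inE e_sym ebr far1.
exact: (star_removable dist_r0 dist_step dist_lip b1R far rR ebr far1).
Qed.

End MaximumLinked.

Lemma connected_colourable : colourable e.
Proof.
have [x0 _|V0] := pickP (@predT V); last first.
  by exists (fun _ _ => 0%R); split=> // u; have := V0 u.
have l1 : linked [set x0].
  apply: (@linkedI _ x0) => [x y|x]; rewrite !inE => /eqP->; last exact: connect0.
  by move/eqP->; rewrite e_irr.
have [R R_linked R_max] := arg_maxnP (fun R : {set V} => #|R|) l1.
have /card_gt0P[r0 r0R] : 0 < #|R| by have := R_max _ l1; rewrite cards1.
have [R_odd|R_even] := boolP (odd #|~: R|).
  exact: colourable_odd R_linked R_max _ r0R R_odd.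
exact: colourable_even R_linked R_max _ r0R R_even.
Qed.

End Regular.

(** * From connected graphs to regular graphs *)

Section Components.
Variables (V : finType) (e : rel V) (d : nat).
Hypotheses (e_sym : symmetric e) (e_irr : irreflexive e).
Hypothesis e_reg : regular e d.
Lemma weighting_of_colourable : colourable e ->
  exists w : {set V} -> nat, edge_weighting e 3 w /\ vertex_colouring e w.
Proof.
case=> a [a_sym a0 a1 aS].
(* The order in which [pick] returns the ends does not matter, as [a] is symmetric; the default [0]
   is never met on an edge. *)
pose w (f : {set V}) := if [pick p : V * V | f == [set p.1; p.2]] is Some p
  then absz (2 + a p.1 p.2)%R else 0.
have wE u v : e u v -> w [set u; v] = absz (2 + a u v)%R.
  move=> euv; have uv : u != v by apply: contraTneq euv => ->; rewrite e_irr.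
  rewrite /w; case: pickP => [[x y] /= /eqP E|/(_ (u, v))]; last by rewrite eqxx.
  have : u \in [set x; y] by rewrite -E !inE eqxx.
  have : v \in [set x; y] by rewrite -E !inE eqxx orbT.
  move: uv; rewrite !inE => uv /orP[] /eqP vE /orP[] /eqP uE.
  - by rewrite vE uE eqxx in uv.
  - by rewrite vE uE a_sym.
  - by rewrite vE uE.
  - by rewrite vE uE eqxx in uv.
exists w; split.
  move=> f /imsetP[[u v]]; rewrite inE /= => euv ->; rewrite wE //.
  by have := a1 u v; lia.
move=> u v euv wuv; apply: (aS u v euv).
have sumE x : ((wsum e w x)%:R = (d.*2)%:R + \sum_y a x y :> int)%R.
  rewrite /wsum natr_sum.
  have -> : (\sum_y a x y = \sum_(y in neighbours e x) a x y)%R.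
    rewrite [RHS]big_mkcond; apply: eq_bigr => y _; rewrite inE.
    by case: ifP => // /negbT/a0.
  have -> : (d.*2%:R = \sum_(y in neighbours e x) 2 :> int)%R.
    by rewrite sumr_const e_reg; lia.
  rewrite -big_split /=; apply: eq_bigr => y; rewrite inE => exy.
  rewrite wE 1?e_sym // (a_sym y x); have := a1 x y; lia.
by have := sumE u; rewrite wuv sumE => /addrI.
Qed.

Hypothesis d_large : 50 <= d.

Lemma component_colourable (x : V) : exists a : V -> V -> int,
  [/\ forall u v, a u v = a v u, forall u v, ~~ e u v -> a u v = 0%R,
      forall u v, (-1 <= a u v <= 1)%R &
      forall u v, connect e x u -> e u v -> (\sum_w a u w)%R <> (\sum_w a v w)%R].
Proof.
pose T := {y : V | connect e x y}; pose f : rel T := relpre val e.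
have f_sym : symmetric f by move=> u v; apply: e_sym.
have f_irr : irreflexive f by move=> u; apply: e_irr.
have f_reg v : #|[set u | f v u]| = d.
  rewrite -(e_reg (val v)) -(card_imset _ val_inj); apply: eq_card => u.
  rewrite [RHS]inE; apply/imsetP/idP => [[w]|evu]; first by rewrite inE => fvw ->.
  have xu : connect e x u by apply: connect_trans (valP v) (connect1 evu).
  by exists (Sub u xu); rewrite ?inE /f /= ?SubK.
have f_conn u v : connect f u v.
  have /connectP[p] : connect e (val u) (val v).
    by apply: connect_trans (valP v); rewrite (sym_connect_sym e_sym); apply: valP.
  elim: p u => [|z p IHp] u /= => [_ /val_inj-> //|].
  case/andP=> euz zp vE.
  have xz : connect e x z by apply: connect_trans (valP u) (connect1 euz).
  apply: (@connect_trans _ _ (Sub z xz)); last exact: IHp.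
  by apply: connect1; rewrite /f /=.
have [a [a_sym a0 a1 aS]] := connected_colourable f_sym f_irr f_reg d_large f_conn.
pose b u v : int := if insub u is Some u' then
  if insub v is Some v' then a u' v' else 0%R else 0%R.
have bS (u : T) : (\sum_w b (val u) w = \sum_w a u w)%R.
  rewrite (bigID (connect e x)) /= [X in (_ + X)%R]big1 ?addr0 => [|w xw]; last first.
    by rewrite /b valK insubN.
  rewrite (reindex_omap (val : T -> V) insub) => [|w xw] /=; last by rewrite insubT.
  rewrite (eq_bigl xpredT) => [|w]; last by rewrite valK eqxx (valP w).
  by apply: eq_bigr => w _; rewrite /b !valK.
exists b; split.
- by move=> u v; rewrite /b; case: (insub u) => [u'|]; case: (insub v).
- move=> u v nuv; rewrite /b; case: insubP => // u' _ uE; case: insubP => // v' _ vE.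
  by rewrite a0 // /f /= uE vE.
- by move=> u v; rewrite /b; case: (insub u) => // u'; case: (insub v).
move=> u v xu euv; have xv : connect e x v := connect_trans xu (connect1 euv).
rewrite -[u]/(val (Sub u xu : T)) -[v]/(val (Sub v xv : T)) !bS.
exact: aS.
Qed.

Lemma regular_colourable : colourable e.
Proof.
have [A AP] := fin_all_exists component_colourable.
have root_edge u v : e u v -> fingraph.root e u = fingraph.root e v.
  by move=> euv; apply/eqP; rewrite root_connect ?connect1 //; apply: sym_connect_sym.
(* Each edge takes its offset from the colouring of its component, indexed by the canonical root
   that both ends share. *)
exists (fun u v => A (fingraph.root e u) u v); split.
- move=> u v; have [euv|nuv] := boolP (e u v).
    by rewrite (root_edge u v) //; case: (AP (fingraph.root e v)).
  by case: (AP (fingraph.root e u)) (AP (fingraph.root e v)) => _ -> // _ _ [_ -> //]; rewrite e_sym.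
- by move=> u v; case: (AP (fingraph.root e u)) => _ + _ _; apply.
- by move=> u v; case: (AP (fingraph.root e u)).
move=> u v euv; rewrite -(root_edge u v) //; case: (AP (fingraph.root e u)) => _ _ _; apply=> //.
by rewrite (sym_connect_sym e_sym) connect_root.
Qed.

End Components.

Theorem theorem3 (d : nat) (hd : 10 ^ 8 <= d)
    (V : finType) (e : rel V)
    (e_sym : symmetric e) (e_irr : irreflexive e)
    (e_reg : regular e d) :
  exists w : {set V} -> nat, edge_weighting e 3 w /\ vertex_colouring e w.
Proof.
have d_large : 50 <= d.
  by apply: leq_trans hd; apply: leq_trans (@leq_pexp2l 10 2 8 _ _).
apply: (weighting_of_colourable e_sym e_irr e_reg).
exact: (regular_colourable e_sym e_irr e_reg d_large).
Qed.
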